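(* Let $G$ be a finite group and $H$ a subgroup with $n$ elements. Let $A_0$ be the $^*$-algebra of complex functions on $G$ (pointwise operations), $B_0=\mathbb C G$ the group algebra with canonical embedding $p\mapsto\lambda_p$, and consider the pairing $\langle f,\lambda_p\rangle=f(p)$ of $A_0$ with $B_0$. Let $E(f)(p)=\frac1{n^2}\sum_{h,k\in H}f(hpk)$ for $f\in A_0$, $u=\frac1n\sum_{h\in H}\lambda_h$, $F(b)=ubu$ for $b\in B_0$, and let $A=E(A_0)$ and $B=F(B_0)=uB_0u$. Then for all $f\in A_0$ and $b\in B_0$ we have $\langle E(f),b\rangle=\langle f,F(b)\rangle$. The restriction of the pairing to $A\times B$ is a pairing of $^*$-algebras. The coproducts induced by this pairing are the coproducts $\Delta(f)=(E\otimes\iota)\Delta_0(f)$ on $A$ and $\Delta(b)=(u\otimes u)\Delta_0(b)(u\otimes u)$ on $B$, where $\Delta_0(f)(p,q)=f(pq)$ and $\Delta_0(\lambda_p)=\lambda_p\otimes\lambda_p$.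
   Context: The involution on $B_0$ is given by $\lambda_p^*=\lambda_{p^{-1}}$. The algebra $A$ is the $^*$-subalgebra of functions on $G$ constant on double cosets of $H$; $B$ is a $^*$-algebra with unit $u$. $\iota$ is the identity map. For a non-degenerate bilinear form $\langle\cdot,\cdot\rangle$ on $A\times B$ of finite-dimensional unital algebras, the induced coproducts are the linear maps $\Delta$ given by $\langle\Delta(a),b\otimes b'\rangle=\langle a,bb'\rangle$ on $A$ and $\langle a\otimes a',\Delta(b)\rangle=\langle aa',b\rangle$ on $B$. If $A$ and $B$ are $^*$-algebras, such a non-degenerate bilinear form is called a pairing of $^*$-algebras if both induced coproducts are $^*$-maps, i.e. $\Delta(x^* )=\Delta(x)^*$ with $(x\otimes y)^*=x^*\otimes y^*$. *)

(* Defs.v *)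
From HB Require Import structures.
From mathcomp Require Import all_boot all_order all_fingroup all_algebra all_field.

Set Implicit Arguments.
Unset Strict Implicit.
Unset Printing Implicit Defensive.

Import Order.TTheory GRing.Theory Num.Theory.
Local Open Scope ring_scope.

(* Algebraic tensor products of finite-dimensional vector spaces.  An element *)
(* of U (x) V is the matrix of its coordinates in the basis e_i (x) e'_j,     *)
(* where e, e' are the bases vbasis {:U}, vbasis {:V}; the lemmas tliftE,     *)
(* tmapE, tmulE and tstarE show that the operations below are the usual,      *)
(* basis-independent ones.                                                    *)
Section Tensor.

Variable K : fieldType.

Definition tens (U V : vectType K) : Type := 'M[K]_(\dim {:U}, \dim {:V}).

HB.instance Definition _ (U V : vectType K) := 
  Vector.copy (tens U V) 'M[K]_(\dim {:U}, \dim {:V}).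

Definition ten (U V : vectType K) (u : U) (v : V) : tens U V :=
  \matrix_(i, j) (coord (vbasis {:U}) i u * coord (vbasis {:V}) j v).

Definition bilin (U V W : lmodType K) (f : U -> V -> W) : Prop :=
  (forall v, linear (f^~ v)) /\ (forall u, linear (f u)).

(* The linear map on U (x) V induced by the bilinear map f. *)
Definition tlift (U V : vectType K) (W : lmodType K) (f : U -> V -> W)
    (t : tens U V) : W :=
  \sum_i \sum_j t i j *: f (vbasis {:U})`_i (vbasis {:V})`_j.

Definition tmap (U V U' V' : vectType K) (f : U -> U') (g : V -> V') :
    tens U V -> tens U' V' :=
  tlift (fun u v => ten (f u) (g v)).

Definition tmul (A B : falgType K) (s t : tens A B) : tens A B :=
  tlift (fun a b => tlift (fun a' b' => ten (a * a') (b * b')) t) s.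

(* The bilinear form <a (x) a', b (x) b'> = <a, b> <a', b'>. *)
Definition tpair (U V : vectType K) (p : U -> V -> K)
    (s : tens U U) (t : tens V V) : K :=
  tlift (fun u u' => tlift (fun v v' => p u v * p u' v' : K^o) t) s.

Lemma coordF_sum (V : vectType K) (v : V) :
  v = \sum_i coord (vbasis {:V}) i v *: (vbasis {:V})`_i.
Proof. exact/coord_vbasis/memvf. Qed.

Lemma ten_bilin (U V : vectType K) : bilin (@ten U V).
Proof.
split=> [v a u u' | u a v v']; apply/matrixP=> i j; rewrite !mxE linearP /=.
  by rewrite mulrDl mulrA.
by rewrite mulrDr mulrCA.
Qed.

Lemma tlift_linear (U V : vectType K) (W : lmodType K) (f : U -> V -> W) :
  linear (tlift f).
Proof.
move=> a s t; rewrite /tlift scaler_sumr -big_split /=; apply: eq_bigr => i _.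
rewrite scaler_sumr -big_split /=; apply: eq_bigr => j _.
by rewrite !mxE scalerDl scalerA.
Qed.

HB.instance Definition _ (U V : vectType K) (W : lmodType K) (f : U -> V -> W) :=
  GRing.isLinear.Build K (tens U V) W *:%R (tlift f) (tlift_linear f).

Lemma linear_sumZ (V W : lmodType K) (f : V -> W) (I : finType)
    (a : I -> K) (v : I -> V) : linear f ->
  f (\sum_i a i *: v i) = \sum_i a i *: f (v i).
Proof.
move=> fL; pose g := GRing.isLinear.Build K V W *:%R f fL.
pose F : {linear V -> W} := HB.pack f g.
rewrite -[f]/(F : V -> W) linear_sum.
by apply: eq_bigr => i _; rewrite linearZ.
Qed.

Lemma tliftE (U V : vectType K) (W : lmodType K) (f : U -> V -> W) u v :
  bilin f -> tlift f (ten u v) = f u v.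
Proof.
move=> [fl fr]; rewrite [in RHS](coordF_sum u) (linear_sumZ _ _ (fl _)).
apply: eq_bigr => i _; rewrite [in RHS](coordF_sum v) (linear_sumZ _ _ (fr _)).
by rewrite scaler_sumr; apply: eq_bigr => j _; rewrite mxE scalerA.
Qed.

Lemma tmapE (U V U' V' : vectType K) (f : U -> U') (g : V -> V') u v :
  linear f -> linear g -> tmap f g (ten u v) = ten (f u) (g v).
Proof.
move=> fL gL; rewrite /tmap tliftE //; split=> [w a x y|w a x y].
  by rewrite fL; apply: (ten_bilin _ _).1.
by rewrite gL; apply: (ten_bilin _ _).2.
Qed.

Lemma eq_tlift (U V : vectType K) (W : lmodType K) (f g : U -> V -> W) :
  f =2 g -> tlift f =1 tlift g.
Proof.
by move=> e t; apply: eq_bigr => i _; apply: eq_bigr => j _; rewrite e.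
Qed.

Lemma tmulE (A B : falgType K) (a a' : A) (b b' : B) :
  tmul (ten a b) (ten a' b') = ten (a * a') (b * b').
Proof.
rewrite /tmul (@eq_tlift _ _ _ _ (fun x y => ten (x * a') (y * b'))).
  apply: tliftE; split=> [w k x y|w k x y]; rewrite mulrDl -scalerAl.
    exact: (ten_bilin A B).1.
  exact: (ten_bilin A B).2.
move=> x y; apply: tliftE; split=> [w k x' y'|w k x' y'].
  by rewrite mulrDr -scalerAr; apply: (ten_bilin A B).1.
by rewrite mulrDr -scalerAr; apply: (ten_bilin A B).2.
Qed.

Lemma tpairE (U V : vectType K) (p : U -> V -> K) (u u' : U) (v v' : V) :
  @bilin U V K^o p -> tpair p (ten u u') (ten v v') = p u v * p u' v'.
Proof.
move=> [pl pr].
rewrite /tpair (@eq_tlift _ _ _ _ (fun x y => p x v * p y v' : K^o)).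
  apply: (@tliftE _ _ K^o); split=> [w k x y|w k x y]; rewrite pl.
    by rewrite mulrDl /GRing.scale /= mulrA.
  by rewrite mulrDr /GRing.scale /= mulrCA.
move=> x y; apply: (@tliftE _ _ K^o); split=> [w k x' y'|w k x' y']; rewrite pr.
  by rewrite mulrDl /GRing.scale /= mulrA.
by rewrite mulrDr /GRing.scale /= mulrCA.
Qed.

End Tensor.

Section StarPairing.

Variable C : numClosedFieldType.

Definition antilin (V W : lmodType C) (s : V -> W) : Prop :=
  forall a u v, s (a *: u + v) = Num.conj a *: s u + s v.

Definition is_star (A : falgType C) (s : A -> A) : Prop :=
  [/\ antilin s, involutive s & forall x y, s (x * y) = s y * s x].

(* The antilinear map with (x (x) y)^* = x^* (x) y^*. *)
Definition tstar (U V : vectType C) (sU : U -> U) (sV : V -> V)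
    (t : tens U V) : tens U V :=
  \sum_i \sum_j
    Num.conj (t i j) *: ten (sU (vbasis {:U})`_i) (sV (vbasis {:V})`_j).

Lemma antilin_sum (V W : lmodType C) (f : V -> W) (I : finType)
    (a : I -> C) (v : I -> V) : antilin f ->
  f (\sum_i a i *: v i) = \sum_i Num.conj (a i) *: f (v i).
Proof.
move=> fL; have f0 : f 0 = 0.
  by have /eqP := fL 1 0 0; rewrite conjC1 !scale1r addr0 -subr_eq subrr eq_sym => /eqP.
elim/big_rec2: _ => // i x y _ <-; exact: fL.
Qed.

Lemma tstarE (U V : vectType C) (sU : U -> U) (sV : V -> V) u v :
  antilin sU -> antilin sV -> tstar sU sV (ten u v) = ten (sU u) (sV v).
Proof.
move=> hU hV; rewrite [in RHS](coordF_sum u) (antilin_sum _ _ hU).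
rewrite (linear_sumZ _ _ ((ten_bilin _ _).1 (sV v))).
apply: eq_bigr => i _; rewrite [in RHS](coordF_sum v) (antilin_sum _ _ hV).
rewrite (linear_sumZ _ _ ((ten_bilin _ _).2 _)) scaler_sumr.
by apply: eq_bigr => j _; rewrite mxE rmorphM scalerA.
Qed.

Variables A B : falgType C.

Definition nondegenerate (p : A -> B -> C) : Prop :=
  (forall a, (forall b, p a b = 0) -> a = 0) /\
  (forall b, (forall a, p a b = 0) -> b = 0).

Definition induced_coproductl (p : A -> B -> C)
    (D : 'Hom(A, tens A A)) : Prop :=
  forall a b b', tpair p (D a) (ten b b') = p a (b * b').

Definition induced_coproductr (p : A -> B -> C)
    (D : 'Hom(B, tens B B)) : Prop :=
  forall a a' b, tpair p (ten a a') (D b) = p (a * a') b.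

Definition star_coproduct (X : falgType C) (s : X -> X)
    (D : 'Hom(X, tens X X)) : Prop :=
  forall x, D (s x) = tstar s s (D x).

(* By non-degeneracy the induced coproducts are unique. *)
Definition star_pairing (sA : A -> A) (sB : B -> B) (p : A -> B -> C) : Prop :=
  [/\ is_star sA /\ is_star sB, @bilin C A B C^o p, nondegenerate p,
      exists2 D, induced_coproductl p D & star_coproduct sA D
    & exists2 D, induced_coproductr p D & star_coproduct sB D].

End StarPairing.

Section FunctionAlgebra.

Variables (C : fieldType) (gT : finGroupType).

Definition fun_alg : Type := {ffun gT -> C}.

HB.instance Definition _ := Vector.copy fun_alg {ffun gT -> C^o}.
Implicit Types f g : fun_alg.

Definition fun_one : fun_alg := [ffun=> 1].
Definition fun_mul f g : fun_alg := [ffun p => f p * g p].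

Fact fun_mulA : associative fun_mul.
Proof. by move=> f g h; apply/ffunP=> p; rewrite !ffunE mulrA. Qed.
Fact fun_mul1l : left_id fun_one fun_mul.
Proof. by move=> f; apply/ffunP=> p; rewrite !ffunE mul1r. Qed.
Fact fun_mul1r : right_id fun_one fun_mul.
Proof. by move=> f; apply/ffunP=> p; rewrite !ffunE mulr1. Qed.
Fact fun_mulDl : left_distributive fun_mul +%R.
Proof. by move=> f g h; apply/ffunP=> p; rewrite !ffunE mulrDl. Qed.
Fact fun_mulDr : right_distributive fun_mul +%R.
Proof. by move=> f g h; apply/ffunP=> p; rewrite !ffunE mulrDr. Qed.
Fact fun_one_neq0 : fun_one != 0.
Proof. by apply/eqP=> /ffunP/(_ 1%g)/eqP; rewrite !ffunE oner_eq0. Qed.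

HB.instance Definition _ := GRing.Zmodule_isNzRing.Build fun_alg
  fun_mulA fun_mul1l fun_mul1r fun_mulDl fun_mulDr fun_one_neq0.

Fact fun_scaleAl (k : C) f g : k *: (f * g) = (k *: f) * g.
Proof. by apply/ffunP=> p; rewrite !ffunE /= scalerAl. Qed.
HB.instance Definition _ := GRing.Lmodule_isLalgebra.Build C fun_alg fun_scaleAl.
Fact fun_scaleAr (k : C) f g : k *: (f * g) = f * (k *: g).
Proof. by apply/ffunP=> p; rewrite !ffunE /= scalerAr. Qed.
HB.instance Definition _ := GRing.Lalgebra_isAlgebra.Build C fun_alg fun_scaleAr.
HB.instance Definition _ := Algebra_isFalgebra.Build C fun_alg.

Definition delta (p : gT) : fun_alg := [ffun q => (q == p)%:R].

Definition teval (t : tens fun_alg fun_alg) (p q : gT) : C :=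
  tlift (fun f g => f p * g q : C^o) t.

(* The coproduct with Delta_0(f)(p, q) = f(pq); see fun_coprodE. *)
Definition fun_coprod (f : fun_alg) : tens fun_alg fun_alg :=
  \sum_p \sum_q f (p * q)%g *: ten (delta p) (delta q).

End FunctionAlgebra.

(* a : group_alg stands for \sum_p a p *: lambda p. *)
Section GroupAlgebra.

Variables (C : fieldType) (gT : finGroupType).

Definition group_alg : Type := {ffun gT -> C}.

HB.instance Definition _ := Vector.copy group_alg {ffun gT -> C^o}.
Implicit Types a b : group_alg.

Definition lambda (p : gT) : group_alg := [ffun q => (q == p)%:R].

Definition group_alg_mul a b : group_alg :=
  [ffun p => \sum_q a q * b (q^-1 * p)%g].

Fact group_alg_mulA : associative group_alg_mul.
Proof.
move=> a b c; apply/ffunP=> p; rewrite !ffunE.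
under eq_bigr => q _ do rewrite ffunE mulr_sumr.
under [RHS]eq_bigr => q _ do rewrite ffunE mulr_suml.
rewrite [RHS]exchange_big /=; apply: eq_bigr => q _.
rewrite [RHS](reindex_inj (mulgI q)) /=; apply: eq_bigr => r _.
by rewrite mulKg invMg !mulgA mulrA.
Qed.
Fact group_alg_mul1l : left_id (lambda 1%g) group_alg_mul.
Proof.
move=> a; apply/ffunP=> p; rewrite ffunE (bigD1 1%g) //= big1 ?addr0.
  by rewrite ffunE eqxx mul1r invg1 mul1g.
by move=> q /negPf q1; rewrite ffunE q1 mul0r.
Qed.
Fact group_alg_mul1r : right_id (lambda 1%g) group_alg_mul.
Proof.
move=> a; apply/ffunP=> p; rewrite ffunE (bigD1 p) //= big1 ?addr0.
  by rewrite ffunE mulVg eqxx mulr1.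
by move=> q /negPf qp; rewrite ffunE -eq_mulVg1 qp mulr0.
Qed.
Fact group_alg_mulDl : left_distributive group_alg_mul +%R.
Proof.
move=> a b c; apply/ffunP=> p; rewrite !ffunE -big_split /=.
by apply: eq_bigr => q _; rewrite !ffunE mulrDl.
Qed.
Fact group_alg_mulDr : right_distributive group_alg_mul +%R.
Proof.
move=> a b c; apply/ffunP=> p; rewrite !ffunE -big_split /=.
by apply: eq_bigr => q _; rewrite !ffunE mulrDr.
Qed.
Fact lambda1_neq0 : lambda 1%g != 0.
Proof. by apply/eqP=> /ffunP/(_ 1%g)/eqP; rewrite !ffunE eqxx oner_eq0. Qed.

HB.instance Definition _ := GRing.Zmodule_isNzRing.Build group_alg
  group_alg_mulA group_alg_mul1l group_alg_mul1r
  group_alg_mulDl group_alg_mulDr lambda1_neq0.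

Fact group_alg_scaleAl (k : C) a b : k *: (a * b) = (k *: a) * b.
Proof.
apply/ffunP=> p; rewrite !ffunE /= scaler_sumr.
by apply: eq_bigr => q _; rewrite !ffunE scalerAl.
Qed.
HB.instance Definition _ :=
  GRing.Lmodule_isLalgebra.Build C group_alg group_alg_scaleAl.
Fact group_alg_scaleAr (k : C) a b : k *: (a * b) = a * (k *: b).
Proof.
apply/ffunP=> p; rewrite !ffunE /= scaler_sumr.
by apply: eq_bigr => q _; rewrite !ffunE scalerAr.
Qed.
HB.instance Definition _ :=
  GRing.Lalgebra_isAlgebra.Build C group_alg group_alg_scaleAr.
HB.instance Definition _ := Algebra_isFalgebra.Build C group_alg.

Lemma lambdaM p q : lambda p * lambda q = lambda (p * q)%g.
Proof.
apply/ffunP=> r; rewrite ffunE (bigD1 p) //= big1 ?addr0.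
  by rewrite !ffunE eqxx mul1r (can2_eq (mulKVg p) (mulKg p)).
by move=> s /negPf sp; rewrite ffunE sp mul0r.
Qed.

Lemma group_alg_sum a : a = \sum_p a p *: lambda p.
Proof.
apply/ffunP=> q; rewrite sum_ffunE (bigD1 q) //= big1 ?addr0.
  by rewrite !ffunE eqxx /GRing.scale /= mulr1.
by move=> r; rewrite eq_sym => /negPf rq; rewrite !ffunE rq scaler0.
Qed.

(* The linear map with Delta_0(lambda_p) = lambda_p (x) lambda_p. *)
Definition group_coprod (b : group_alg) : tens group_alg group_alg :=
  \sum_p b p *: ten (lambda p) (lambda p).

Lemma group_coprod_lambda p :
  group_coprod (lambda p) = ten (lambda p) (lambda p).
Proof.
rewrite /group_coprod (bigD1 p) //= ffunE eqxx scale1r big1 ?addr0 // => q qp.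
by rewrite ffunE (negPf qp) scale0r.
Qed.

End GroupAlgebra.

Lemma fun_coprodE (C : fieldType) (gT : finGroupType) (f : fun_alg C gT) p q :
  teval (fun_coprod f) p q = f (p * q)%g.
Proof.
have [T tE] : {T : {linear tens (fun_alg C gT) (fun_alg C gT) -> C^o} |
    forall t, teval t p q = T t}.
  by exists (tlift (fun f g : fun_alg C gT => f p * g q : C^o)).
have TZ (a : C) t : T (a *: t) = a * T t by exact: linearZ_LR.
have TE x y : T (ten (delta C x) (delta C y)) = (p == x)%:R * (q == y)%:R.
  rewrite -tE [LHS](@tliftE _ _ _ C^o); first by rewrite !ffunE.
  split=> [w k u v|w k u v]; rewrite !ffunE.
    by rewrite mulrDl /GRing.scale /= mulrA.
  by rewrite mulrDr /GRing.scale /= mulrCA.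
rewrite tE /fun_coprod linear_sum (bigD1 p) //= [X in _ + X]big1 => [|x xp].
  rewrite addr0 linear_sum (bigD1 q) //= TZ TE !eqxx.
  rewrite [X in _ + X]big1 ?addr0 ?mulr1 // => y yq.
  by rewrite TZ TE [q == y]eq_sym (negPf yq) !mulr0.
rewrite linear_sum big1 // => y _.
by rewrite TZ TE eq_sym (negPf xp) mul0r mulr0.
Qed.

Section Hecke.

Variables (C : numClosedFieldType) (gT : finGroupType).
Local Notation A0 := (fun_alg C gT).
Local Notation B0 := (group_alg C gT).

Definition fun_star (f : A0) : A0 := [ffun p => Num.conj (f p)].

(* The antilinear map with lambda_p^* = lambda_{p^-1}. *)
Definition group_star (b : B0) : B0 := [ffun p => Num.conj (b p^-1%g)].

Lemma group_star_lambda p : group_star (lambda C p) = lambda C p^-1%g.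
Proof.
by apply/ffunP=> q; rewrite !ffunE -(inj_eq invg_inj) invgK conjC_nat.
Qed.

Lemma group_starM (a b : B0) :
  group_star (a * b) = group_star b * group_star a.
Proof.
apply/ffunP=> p; rewrite !ffunE rmorph_sum (reindex_inj (mulgI p^-1%g)) /=.
apply: eq_bigr => q _.
by rewrite rmorphM mulrC !ffunE !invMg !invgK mulgK.
Qed.

(* The bilinear form with <f, lambda_p> = f(p). *)
Definition pairing0 (f : A0) (b : B0) : C := \sum_p f p * b p.

Lemma pairing0_lambda f p : pairing0 f (lambda C p) = f p.
Proof.
rewrite /pairing0 (bigD1 p) //= big1 ?addr0; first by rewrite ffunE eqxx mulr1.
by move=> q /negPf qp; rewrite ffunE qp mulr0.
Qed.

Variable H : {group gT}.

Definition avg (f : A0) : A0 :=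
  [ffun p => (#|H|%:R ^+ 2)^-1 * \sum_(h in H) \sum_(k in H) f (h * p * k)%g].

Definition unit_proj : B0 := #|H|%:R^-1 *: \sum_(h in H) lambda C h.

Definition corner (b : B0) : B0 := unit_proj * b * unit_proj.

Lemma avg_linear : linear avg.
Proof.
move=> a f g; apply/ffunP=> p; rewrite !ffunE /GRing.scale /= mulrCA -mulrDr.
congr (_ * _); rewrite mulr_sumr -big_split /=; apply: eq_bigr => h _.
rewrite mulr_sumr -big_split /=; apply: eq_bigr => k _.
by rewrite !ffunE.
Qed.

HB.instance Definition _ := GRing.isLinear.Build C A0 A0 *:%R avg avg_linear.

Lemma corner_linear : linear corner.
Proof.
move=> a b c; rewrite /corner mulrDr -(scalerAr a unit_proj b) mulrDl.
by rewrite -(scalerAl a).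
Qed.

HB.instance Definition _ :=
  GRing.isLinear.Build C B0 B0 *:%R corner corner_linear.

Fact cardH_neq0 : #|H|%:R != 0 :> C.
Proof. by rewrite pnatr_eq0 -lt0n cardG_gt0. Qed.

Definition A_space : {vspace A0} := limg (linfun avg).
Definition B_space : {vspace B0} := limg (linfun corner).

Lemma mem_A_space f : reflect (exists g, f = avg g) (f \in A_space).
Proof.
apply: (iffP memv_imgP) => [[g _ ->]|[g ->]]; exists g;
  by rewrite ?memvf ?lfunE.
Qed.

Lemma mem_B_space b : reflect (exists c, b = corner c) (b \in B_space).
Proof.
apply: (iffP memv_imgP) => [[g _ ->]|[g ->]]; exists g;
  by rewrite ?memvf ?lfunE.
Qed.

Lemma A_spaceP (f : A0) :
  (forall h p k, h \in H -> k \in H -> f (h * p * k)%g = f p) <->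
  f \in A_space.
Proof.
split=> [fH | /mem_A_space[g ->] h p k hH kH].
  apply/mem_A_space; exists f; apply/ffunP=> p; rewrite ffunE.
  rewrite (eq_bigr (fun=> f p *+ #|H|)) => [|h hH].
    rewrite sumr_const -mulrnA -[X in _ * X]mulr_natl natrM -expr2.
    by rewrite mulKf // expf_neq0 ?cardH_neq0.
  by rewrite (eq_bigr (fun=> f p)) ?sumr_const // => k kH; rewrite fH.
rewrite !ffunE; congr (_ * _).
rewrite (reindex_inj (mulIg h^-1%g)) /=.
apply: eq_big => [x|x _]; first by rewrite groupMr ?groupV.
rewrite (reindex_inj (mulgI k^-1%g)) /=.
apply: eq_big => [y|y _]; first by rewrite groupMl ?groupV.
by congr (g _); rewrite !mulgA mulgKV mulgK.
Qed.


Fact A_aspace_subproof : is_aspace A_space.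
Proof.
apply/andP; split.
  apply: has_algid1; apply/A_spaceP => h p k _ _.
  by rewrite !ffunE.
apply/prodvP=> f g /A_spaceP fH /A_spaceP gH; apply/A_spaceP => h p k hH kH.
by rewrite !ffunE fH ?gH.
Qed.
Canonical A_aspace := ASpace A_aspace_subproof.

Lemma unit_projM h : h \in H -> lambda C h * unit_proj = unit_proj.
Proof.
move=> hH; rewrite /unit_proj -scalerAr mulr_sumr; congr (_ *: _).
under eq_bigr => k _ do rewrite lambdaM.
rewrite [RHS](reindex_inj (mulgI h)) /=.
by apply: eq_bigl => k; rewrite groupMl.
Qed.

Lemma unit_proj_idem : unit_proj * unit_proj = unit_proj.
Proof.
rewrite {1}/unit_proj -scalerAl mulr_suml.
rewrite (eq_bigr (fun=> unit_proj)) => [|h hH]; last exact: unit_projM.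
by rewrite sumr_const -scaler_nat scalerA mulVf ?scale1r ?cardH_neq0.
Qed.

Lemma unit_projE p : unit_proj p = #|H|%:R^-1 * (p \in H)%:R.
Proof.
rewrite ffunE sum_ffunE /GRing.scale /=; congr (_ * _).
have [pH | pH] := boolP (p \in H).
  rewrite (bigD1 p) //= ffunE eqxx big1 ?addr0 // => h /andP[_ hp].
  by rewrite ffunE eq_sym (negPf hp).
rewrite big1 // => h hH; rewrite ffunE.
by have [ph|//] := eqVneq p h; rewrite ph hH in pH.
Qed.

Lemma group_star_unit : group_star unit_proj = unit_proj.
Proof.
apply/ffunP=> p; rewrite ffunE !unit_projE groupV rmorphM fmorphV.
by rewrite !rmorph_nat.
Qed.

Lemma unit_proj_neq0 : unit_proj != 0.
Proof.
apply/eqP=> /ffunP/(_ 1%g)/eqP; rewrite unit_projE group1 mulr1 ffunE.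
by rewrite invr_eq0 (negPf cardH_neq0).
Qed.

Fact B_aspace_subproof : is_aspace B_space.
Proof.
apply/andP; split.
  apply/has_algidP; exists unit_proj; split.
  - by apply/mem_B_space; exists 1; rewrite /corner mulr1 unit_proj_idem.
  - exact: unit_proj_neq0.
  move=> _ /mem_B_space[c ->]; rewrite /corner.
  by split; [rewrite !mulrA unit_proj_idem | rewrite -(mulrA (_ * c)) unit_proj_idem].
apply/prodvP=> _ _ /mem_B_space[c ->] /mem_B_space[d ->]; apply/mem_B_space.
exists (c * unit_proj * d); rewrite /corner !mulrA.
by rewrite -(mulrA (unit_proj * c) unit_proj unit_proj) unit_proj_idem.
Qed.
Canonical B_aspace := ASpace B_aspace_subproof.

(* The unit of algB is unit_proj rather than 1; see algB_unitE. *)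
Definition algA : falgType C := subvs_of A_aspace.
Definition algB : falgType C := subvs_of B_aspace.

Lemma algA_unitE : vsval (1 : algA) = 1.
Proof.
apply/eqP; rewrite -[vsval 1]/(algid A_aspace) algid_eq1.
by apply/A_spaceP => h p k _ _; rewrite !ffunE.
Qed.

Lemma algB_unitE : vsval (1 : algB) = unit_proj.
Proof.
have uB : unit_proj \in B_space.
  by apply/mem_B_space; exists 1; rewrite /corner mulr1 unit_proj_idem.
rewrite -[RHS](algidr (A := B_aspace) uB) -[LHS]/(algid B_aspace).
have /mem_B_space[c ->] := memv_algid B_aspace.
by rewrite /corner !mulrA unit_proj_idem.
Qed.

Lemma fun_star_A (f : algA) : fun_star (vsval f) \in A_space.
Proof.
have /A_spaceP fH := subvsP f; apply/A_spaceP => h p k hH kH.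
by rewrite !ffunE fH.
Qed.

Lemma group_star_B (b : algB) : group_star (vsval b) \in B_space.
Proof.
have /mem_B_space[c ->] := subvsP b; apply/mem_B_space; exists (group_star c).
by rewrite /corner !group_starM group_star_unit mulrA.
Qed.

Definition starA (f : algA) : algA := Subvs (fun_star_A f).
Definition starB (b : algB) : algB := Subvs (group_star_B b).
Definition pairingAB (f : algA) (b : algB) : C := pairing0 (vsval f) (vsval b).

End Hecke.

(* Main.v *)
(* As functions on G, E(f) and F(b) are given by the same formula, so E and F *)
(* are adjoint for <f, b> = sum_p f(p) b(p), and A and B are both the         *)
(* biinvariant functions; this gives the restricted non-degeneracy.  The      *)
(* coproducts are written down explicitly, as                                 *)
(*   f |-> sum_(p, q) f(pq) E(delta_p) (x) E(delta_q)  and                    *)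
(*   b |-> sum_p b(p) F(lambda_p) (x) F(lambda_p),                            *)
(* and non-degeneracy of the form on tensor products makes them the only      *)
(* induced ones.  On A, the second E can be dropped: sum_p f(pq) E(delta_p)   *)
(* is the average of f(. q), which is already biinvariant in q.               *)
From HB Require Import structures.
Require Import Defs.
From mathcomp Require Import all_boot all_order all_fingroup all_algebra all_field.
From mathcomp Require Import reals complex.

Set Implicit Arguments.
Unset Strict Implicit.
Unset Printing Implicit Defensive.

Import Order.TTheory GRing.Theory Num.Theory.
Local Open Scope ring_scope.

(** Write [E] and [F] for [avg] and [corner]. Both are idempotent, so adjointness gives [<f,
    F(lambda_p)> = <E(f), lambda_p> = f(p)] for [f] in A, and likewise [<E(delta_p), b> = b(p)] for
    [b] in B ([pairingAB_projB], [pairingAB_projA]). Thus the restricted pairing sees every value of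
    [f] and of [b]. This yields non-degeneracy and turns the defining identities of the induced
    coproducts into identities of sums over the group: convolution for A, pointwise product for B.
    The coproducts are star maps because [E(delta_p)] is self-adjoint and
    [F(lambda_p)^* = F(lambda_{p^-1})]. Any other induced coproduct agrees with the explicit one by
    [tpair_eq0]; the stated formulas are then checked inside the tensor squares of A0 and B0
    ([tmap_coprodA], [tmap_coprodB]). *)

Section TensorPairing.

Variable K : fieldType.

(** * Linearity and non-degeneracy of the form on tensor squares *)

Lemma tmap_linear (U V U' V' : vectType K) (f : U -> U') (g : V -> V') :
  linear (tmap f g).
Proof. exact: tlift_linear. Qed.

Lemma tmul_linearl (A B : falgType K) (t : tens A B) : linear ((@tmul K A B)^~ t).
Proof. exact: tlift_linear. Qed.

(** Gives linearity of [tmul] and [tpair] in their second argument, which sits inside the outer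
    [tlift]. *)
Lemma tlift_linear_fun (U V : vectType K) (W X : lmodType K)
    (f : X -> U -> V -> W) (t : tens U V) :
  (forall u v, linear (fun x => f x u v)) -> linear (fun x => tlift (f x) t).
Proof.
move=> fL k x y; rewrite scaler_sumr -big_split; apply: eq_bigr => i _ /=.
rewrite scaler_sumr -big_split; apply: eq_bigr => j _ /=.
by rewrite fL scalerDr !scalerA mulrC.
Qed.

Lemma tmul_linearr (A B : falgType K) (s : tens A B) : linear (tmul s).
Proof. by apply: tlift_linear_fun => u v; apply: tlift_linear. Qed.

Variables U V : vectType K.
Implicit Type p : U -> V -> K.

(** Both sides are the same fourfold sum over basis vectors. This carries statements about the left
    factor over to the right one. *)
Lemma tpair_sym p s t : tpair p s t = tpair (fun v u => p u v) t s.
Proof.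
rewrite /tpair /tlift.
under eq_bigr do under eq_bigr do rewrite scaler_sumr.
under eq_bigr do under eq_bigr do under eq_bigr do rewrite scaler_sumr.
under [RHS]eq_bigr do under eq_bigr do rewrite scaler_sumr.
under [RHS]eq_bigr do under eq_bigr do under eq_bigr do rewrite scaler_sumr.
rewrite pair_bigA [RHS]pair_bigA /=.
under eq_bigr do rewrite pair_bigA.
under [RHS]eq_bigr do rewrite pair_bigA.
rewrite exchange_big; apply: eq_bigr => x _; apply: eq_bigr => y _ /=.
by rewrite !scalerA (mulrC (s _ _)).
Qed.

Lemma tpair_linearl p t : linear ((tpair p)^~ t : tens U U -> K^o).
Proof. exact: (@tlift_linear K U U K^o). Qed.

Lemma tpair_linearr p s : linear (tpair p s : tens V V -> K^o).
Proof.
apply: (@tlift_linear_fun U U K^o (tens V V)) => u u'.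
exact: (@tlift_linear K V V K^o).
Qed.

Lemma tpair_tenr p t v v' : @bilin K U V K^o p ->
  tpair p t (ten v v') =
  \sum_i \sum_j t i j * (p (vbasis {:U})`_i v * p (vbasis {:U})`_j v').
Proof.
move=> [pl pr]; apply: eq_bigr => i _; apply: eq_bigr => j _; congr (_ * _).
apply: (@tliftE _ _ _ K^o); split=> [w k x y|w k x y]; rewrite pr.
  by rewrite mulrDl /GRing.scale /= mulrA.
by rewrite mulrDr /GRing.scale /= mulrCA.
Qed.

(** One leg is removed at a time: non-degeneracy together with freeness of the basis kills the
    coefficients of the second leg, tested against [v'], and then those of the first, tested against
    [v]. *)
Lemma tpair_eq0 p : @bilin K U V K^o p ->
    (forall u, (forall v, p u v = 0) -> u = 0) ->
  forall t, (forall v v', tpair p t (ten v v') = 0) -> t = 0.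
Proof.
move=> pB nd t t0.
have fr : free (vbasis {:U}) := basis_free (vbasisP _).
have pS (c : 'I_(\dim {:U}) -> K) v :
    p (\sum_i c i *: (vbasis {:U})`_i) v = \sum_i c i * p (vbasis {:U})`_i v.
  exact: (linear_sumZ (W := K^o) _ _ (pB.1 v)).
apply/matrixP=> i j; rewrite mxE; move: j.
apply: (freeP fr (t i)); apply: (nd) => v'; rewrite pS; move: i.
apply: (freeP fr (fun i => \sum_j t i j * p (vbasis {:U})`_j v')).
apply: (nd) => v; rewrite pS -[RHS](t0 v v') tpair_tenr //.
apply: eq_bigr => i _; rewrite mulr_suml; apply: eq_bigr => j _.
by rewrite -mulrA; congr (_ * _); rewrite mulrC.
Qed.

End TensorPairing.

HB.instance Definition _ (K : fieldType) (U V : vectType K) (u : U) :=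
  GRing.isLinear.Build K V (tens U V) *:%R (ten u) ((ten_bilin U V).2 u).

(** * Uniqueness of the induced coproducts *)

Section InducedCoproduct.

Variable C : numClosedFieldType.

Lemma tstar_antilin (U V : vectType C) (sU : U -> U) (sV : V -> V) :
  antilin (tstar sU sV).
Proof.
move=> a s t; rewrite /tstar scaler_sumr -big_split /=; apply: eq_bigr => i _.
rewrite scaler_sumr -big_split /=; apply: eq_bigr => j _.
by rewrite !mxE rmorphD rmorphM scalerDl scalerA.
Qed.

Variables (A B : falgType C) (p : A -> B -> C).
Hypotheses (pB : @bilin C A B C^o p) (pN : Defs.nondegenerate p).

Lemma induced_coproductl_unique D D' :
  induced_coproductl p D -> induced_coproductl p D' -> D =1 D'.
Proof.
move=> hD hD' a; apply/eqP; rewrite -subr_eq0; apply/eqP.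
apply: (tpair_eq0 pB pN.1) => b b'.
by rewrite addrC -scaleN1r tpair_linearl hD hD' scaleN1r addNr.
Qed.

Lemma induced_coproductr_unique D D' :
  induced_coproductr p D -> induced_coproductr p D' -> D =1 D'.
Proof.
move=> hD hD' b; apply/eqP; rewrite -subr_eq0; apply/eqP.
(* The transposed form has B on the left, so the other half of non-degeneracy applies. *)
apply: (@tpair_eq0 _ _ _ (fun b a => p a b) _ pN.2) => [|a a'].
  by split=> v; [apply: pB.2 | apply: pB.1].
rewrite -(tpair_sym p) addrC -scaleN1r.
by rewrite tpair_linearr hD hD' scaleN1r addNr.
Qed.

End InducedCoproduct.

(** * Averaging over double cosets and adjointness of [avg] and [corner] *)

Section HeckePairing.

Variables (C : numClosedFieldType) (gT : finGroupType) (H : {group gT}).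
Local Notation A0 := (fun_alg C gT).
Local Notation B0 := (group_alg C gT).
Local Notation A := (algA C H).
Local Notation B := (algB C H).
Local Notation n := (#|H|%:R : C).

Lemma unit_projMl (b : B0) p :
  (unit_proj C H * b) p = n^-1 * \sum_(h in H) b (h * p)%g.
Proof.
rewrite ffunE mulr_sumr (big_mkcond (mem H)) /= (reindex_inj invg_inj) /=.
apply: eq_bigr => q _; rewrite unit_projE groupV invgK.
by case: ifP => _; rewrite ?mulr1 // mulr0 mul0r.
Qed.

Lemma unit_projMr (b : B0) p :
  (b * unit_proj C H) p = n^-1 * \sum_(k in H) b (p * k)%g.
Proof.
rewrite ffunE mulr_sumr (big_mkcond (mem H)) /= (reindex_inj (mulgI p)) /=.
apply: eq_bigr => q _; rewrite unit_projE invMg mulgKV groupV mulrC.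
by case: ifP => _; rewrite ?mulr1 // mulr0 mul0r.
Qed.

(* As functions on [gT], [u b u] is the average of [b] over double cosets. *)
Lemma corner_avg (b : B0) : corner H b = avg H b.
Proof.
apply/ffunP=> p; rewrite /corner unit_projMr [RHS]ffunE.
under eq_bigr do rewrite unit_projMl.
rewrite -mulr_sumr mulrA expr2 invfM exchange_big /=; congr (_ * _).
by apply: eq_bigr => h _; apply: eq_bigr => k _; rewrite mulgA.
Qed.

Lemma avg_delta q : avg H (delta C q) =
  (n ^+ 2)^-1 *: \sum_(h in H) \sum_(k in H) delta C (h * q * k)%g.
Proof.
apply/ffunP=> r; rewrite !ffunE /GRing.scale /=; congr (_ * _).
rewrite sum_ffunE (reindex_inj invg_inj) /=.
apply: eq_big => [h|h _]; first by rewrite groupV.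
rewrite sum_ffunE (reindex_inj invg_inj) /=.
apply: eq_big => [k|k _]; first by rewrite groupV.
rewrite !ffunE; congr (nat_of_bool _)%:R.
by rewrite (can2_eq (mulgKV k) (mulgK k)) (can2_eq (mulKVg h) (mulKg h)) mulgA.
Qed.

(** For fixed [h] and [k] the map [p |-> h p k] permutes the group, and inversion permutes H. On the
    right [b] is read as a function, since [fun_alg] and [group_alg] have the same carrier. *)
Lemma pairing0_avg (f : A0) (b : B0) :
  pairing0 (avg H f) b = pairing0 f (avg H b).
Proof.
rewrite /pairing0.
transitivity ((n ^+ 2)^-1 *
    \sum_(h in H) \sum_(k in H) \sum_p f (h * p * k)%g * b p).
  under eq_bigr do rewrite ffunE -mulrA.
  rewrite -mulr_sumr; congr (_ * _).
  under eq_bigr do rewrite mulr_suml.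
  rewrite exchange_big /=; apply: eq_bigr => h _.
  under eq_bigr do rewrite mulr_suml.
  by rewrite exchange_big.
under [RHS]eq_bigr do rewrite ffunE mulrCA.
rewrite -[RHS]mulr_sumr; congr (_ * _).
under [RHS]eq_bigr do rewrite mulr_sumr.
rewrite [RHS]exchange_big /= [RHS](reindex_inj invg_inj) /=.
apply: eq_big => [h|h _]; first by rewrite groupV.
under [RHS]eq_bigr do rewrite mulr_sumr.
rewrite [RHS]exchange_big /= [RHS](reindex_inj invg_inj) /=.
apply: eq_big => [k|k _]; first by rewrite groupV.
rewrite [RHS](reindex_inj (mulgI h)) [RHS](reindex_inj (mulIg k)) /=.
by apply: eq_bigr => q _; rewrite !mulgA mulVg mul1g mulgK.
Qed.

Lemma pairing0_corner (f : A0) (b : B0) :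
  pairing0 (avg H f) b = pairing0 f (corner H b).
Proof. by rewrite corner_avg pairing0_avg. Qed.

Lemma avg_id (f : A) : avg H (vsval f) = vsval f.
Proof.
have /A_spaceP fH := subvsP f; apply/ffunP=> p; rewrite ffunE.
rewrite (eq_bigr (fun=> vsval f p *+ #|H|)) => [|h hH].
  rewrite sumr_const -mulrnA -[X in _ * X]mulr_natl natrM -expr2.
  by rewrite mulKf // expf_neq0 ?cardH_neq0.
by rewrite (eq_bigr (fun=> vsval f p)) ?sumr_const // => k kH; rewrite fH.
Qed.

Lemma corner_id (b : B) : corner H (vsval b) = vsval b.
Proof.
have /mem_B_space[c ->] := subvsP b; rewrite /corner !mulrA unit_proj_idem.
by rewrite -mulrA unit_proj_idem.
Qed.

Lemma avg_A_space (f : A0) : avg H f \in A_space C H.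
Proof. by apply/mem_A_space; exists f. Qed.

Lemma corner_B_space (b : B0) : corner H b \in B_space C H.
Proof. by apply/mem_B_space; exists b. Qed.

(** * The restricted pairing, its involutions and its coproducts *)

Definition projA (f : A0) : A := Subvs (avg_A_space f).
Definition projB (b : B0) : B := Subvs (corner_B_space b).

Lemma fun_star_involutive : involutive (@fun_star C gT).
Proof. by move=> f; apply/ffunP=> p; rewrite !ffunE conjCK. Qed.

Lemma group_star_involutive : involutive (@group_star C gT).
Proof. by move=> f; apply/ffunP=> p; rewrite !ffunE conjCK invgK. Qed.

Lemma starA_star : is_star (@starA C gT H).
Proof.
split=> [a f g|f|f g]; apply/val_inj => /=.
- by apply/ffunP=> p; rewrite !ffunE rmorphD rmorphM.
- exact: fun_star_involutive.
- by apply/ffunP=> p; rewrite !ffunE rmorphM mulrC.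
Qed.

Lemma starB_star : is_star (@starB C gT H).
Proof.
split=> [a b c|b|b c]; apply/val_inj => /=.
- by apply/ffunP=> p; rewrite !ffunE rmorphD rmorphM.
- exact: group_star_involutive.
- exact: group_starM.
Qed.

Lemma pairingAB_bilin : @bilin C A B C^o (@pairingAB C gT H).
Proof.
split=> [b a f g|f a b c]; rewrite /pairingAB /pairing0 /=.
  rewrite scaler_sumr -big_split /=; apply: eq_bigr => p _.
  by rewrite !ffunE mulrDl /GRing.scale /= mulrA.
rewrite scaler_sumr -big_split /=; apply: eq_bigr => p _.
by rewrite !ffunE mulrDr /GRing.scale /= mulrCA.
Qed.

Lemma pairingAB_projB (f : A) p :
  pairingAB f (projB (lambda C p)) = vsval f p.
Proof. by rewrite /pairingAB /= -pairing0_corner avg_id pairing0_lambda. Qed.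

Lemma pairingAB_projA p (b : B) :
  pairingAB (projA (delta C p)) b = vsval b p.
Proof.
rewrite /pairingAB /= pairing0_corner corner_id /pairing0.
rewrite (bigD1 p) //= big1 ?addr0; first by rewrite ffunE eqxx mul1r.
by move=> q /negPf qp; rewrite ffunE qp mul0r.
Qed.

Lemma pairingAB_nondegenerate : Defs.nondegenerate (@pairingAB C gT H).
Proof.
split=> [f f0|b b0]; apply/val_inj/ffunP => p; rewrite [RHS]ffunE.
  by rewrite -(f0 (projB (lambda C p))) pairingAB_projB.
by rewrite -(b0 (projA (delta C p))) pairingAB_projA.
Qed.

(** This is [(E (x) E) Delta_0(f)]: both legs are projected so that the value lies in the tensor
    square of A. A single sum over pairs lets [linear_sumZ] apply once. *)
Definition coprodA (f : A) : tens A A :=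
  \sum_(x : gT * gT) vsval f (x.1 * x.2)%g *:
    ten (projA (delta C x.1)) (projA (delta C x.2)).

Fact coprodA_linear : linear coprodA.
Proof.
move=> a f g; rewrite scaler_sumr -big_split; apply: eq_bigr => x _ /=.
by rewrite !ffunE scalerDl scalerA.
Qed.
HB.instance Definition _ :=
  GRing.isLinear.Build C A (tens A A) *:%R coprodA coprodA_linear.

Definition coprodB (b : B) : tens B B :=
  \sum_p vsval b p *: ten (projB (lambda C p)) (projB (lambda C p)).

Fact coprodB_linear : linear coprodB.
Proof.
move=> a b c; rewrite scaler_sumr -big_split; apply: eq_bigr => p _ /=.
by rewrite !ffunE scalerDl scalerA.
Qed.
HB.instance Definition _ :=
  GRing.isLinear.Build C B (tens B B) *:%R coprodB coprodB_linear.

Lemma coprodA_induced : induced_coproductl (@pairingAB C gT H) (linfun coprodA).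
Proof.
move=> f b b'; rewrite lfunE /=.
rewrite (linear_sumZ (W := C^o) _ _ (tpair_linearl _ _)).
rewrite -[RHS]/(\sum_p vsval f p * vsval (b * b') p).
under [RHS]eq_bigr do rewrite ffunE mulr_sumr.
rewrite [RHS]exchange_big /= -(pair_bigA _ (fun p q => vsval f (p * q)%g *:
  (tpair (@pairingAB C gT H) (ten (projA (delta C p)) (projA (delta C q)))
     (ten b b') : C^o))) /=.
(* Substituting [p * q] for the argument of [f] turns the convolution factor [b' (p^-1 * _)] into
   [b' q]. *)
apply: eq_bigr => p _; rewrite [RHS](reindex_inj (mulgI p)) /=.
apply: eq_bigr => q _; rewrite (tpairE _ _ _ _ pairingAB_bilin).
by rewrite !pairingAB_projA mulKg.
Qed.

(** Both legs sit at the same [p], so pairing with [f] and [g] produces [f(p) g(p)], the pointwise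
    product of A. *)
Lemma coprodB_induced : induced_coproductr (@pairingAB C gT H) (linfun coprodB).
Proof.
move=> f g b; rewrite lfunE /=.
rewrite (linear_sumZ (W := C^o) _ _ (tpair_linearr _ _)).
apply: eq_bigr => p _; rewrite (tpairE _ _ _ _ pairingAB_bilin).
by rewrite !pairingAB_projB [RHS]mulrC /= [in RHS]ffunE.
Qed.

Lemma starA_proj_delta p : starA (projA (delta C p)) = projA (delta C p).
Proof.
apply/val_inj/ffunP=> q; rewrite !ffunE rmorphM fmorphV rmorphXn rmorph_nat.
congr (_ * _); rewrite rmorph_sum; apply: eq_bigr => h _.
by rewrite rmorph_sum; apply: eq_bigr => k _; rewrite ffunE rmorph_nat.
Qed.

Lemma starB_proj_lambda p :
  starB (projB (lambda C p)) = projB (lambda C p^-1%g).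
Proof.
apply/val_inj; rewrite /= /corner !group_starM group_star_unit.
by rewrite group_star_lambda mulrA.
Qed.

Lemma coprodA_star : star_coproduct (@starA C gT H) (linfun coprodA).
Proof.
move=> f; rewrite !lfunE /= (antilin_sum _ _ (tstar_antilin _ _)).
have [sl _ _] := starA_star; apply: eq_bigr => x _.
by rewrite tstarE // !starA_proj_delta ffunE.
Qed.

Lemma coprodB_star : star_coproduct (@starB C gT H) (linfun coprodB).
Proof.
move=> b; rewrite !lfunE /= (antilin_sum _ _ (tstar_antilin _ _)).
(* The involution inverts the group element in the coefficient as well as in both legs; the
   reindexing matches the two. *)
have [sl _ _] := starB_star; rewrite [LHS](reindex_inj invg_inj) /=.
by apply: eq_bigr => p _; rewrite tstarE // !starB_proj_lambda ffunE invgK.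
Qed.

Lemma pairingAB_star_pairing :
  star_pairing (@starA C gT H) (@starB C gT H) (@pairingAB C gT H).
Proof.
split.
- by split; [apply: starA_star | apply: starB_star].
- exact: pairingAB_bilin.
- exact: pairingAB_nondegenerate.
- by exists (linfun coprodA); [apply: coprodA_induced | apply: coprodA_star].
- by exists (linfun coprodB); [apply: coprodB_induced | apply: coprodB_star].
Qed.

(** * The coproducts seen in the tensor squares of A0 and B0 *)

Lemma vsval_linear (V : vectType C) (W : {vspace V}) : linear (@vsval C V W).
Proof. by move=> a u v; rewrite linearP. Qed.

(** Expanding the average gives [#|H| ^ 2] sums, one for each [h] and [k]. Each equals the
    right-hand side after the substitution [q |-> h q k], because [F] is biinvariant. *)
Lemma sum_ten_avg_delta (V : vectType C) (F : gT -> V) :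
    (forall h q k, h \in H -> k \in H -> F (h * q * k)%g = F q) ->
  \sum_q ten (F q) (avg H (delta C q)) = \sum_q ten (F q) (delta C q).
Proof.
move=> FH.
under eq_bigr do rewrite avg_delta linearZ linear_sum.
rewrite -scaler_sumr exchange_big /=.
rewrite (eq_bigr (fun=> (\sum_q ten (F q) (delta C q)) *+ #|H|)) => [|h hH].
  rewrite sumr_const -mulrnA mulnn -scaler_nat natrX scalerA.
  by rewrite mulVf ?scale1r // expf_neq0 ?cardH_neq0.
under eq_bigr do rewrite linear_sum.
rewrite exchange_big -sumr_const; apply: eq_bigr => k kH.
rewrite [RHS](reindex_inj (mulgI h)) [RHS](reindex_inj (mulIg k)) /=.
by apply: eq_bigr => q _; rewrite !mulgA FH.
Qed.

Lemma delta_sum (f : A0) : f = \sum_p f p *: delta C p.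
Proof. exact: (@group_alg_sum C gT f). Qed.

(** The first leg of [(E (x) iota) Delta_0(f)] that accompanies [delta q] in the second. *)
Definition avg_shift (f : A0) q : A0 := avg H [ffun p => f (p * q)%g].

(** The factor [h] is absorbed by the averaging on the right of [p], and [k] by the right invariance
    of [f]. *)
Lemma avg_shift_invariant (f : A) h q k : h \in H -> k \in H ->
  avg_shift (vsval f) (h * q * k)%g = avg_shift (vsval f) q.
Proof.
move=> hH kH; have /A_spaceP fH := subvsP f; apply/ffunP=> p; rewrite !ffunE.
congr (_ * _); apply: eq_bigr => h' _.
rewrite [RHS](reindex_inj (mulIg h)) /=.
apply: eq_big => [k'|k' _]; first by rewrite groupMr.
by rewrite !ffunE -[RHS](fH 1%g _ k) // mul1g !mulgA.
Qed.

(** With [g q] equal to [E(delta_q)] or to [delta_q] this covers both sides of [tmap_coprodA]. *)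
Lemma sum_ten_avg_shift (f : A0) (V : vectType C) (g : gT -> V) :
  \sum_(x : gT * gT) f (x.1 * x.2)%g *: ten (avg H (delta C x.1)) (g x.2) =
  \sum_q ten (avg_shift f q) (g q).
Proof.
rewrite -(pair_bigA _ (fun p q =>
  f (p * q)%g *: ten (avg H (delta C p)) (g q))) exchange_big /=.
apply: eq_bigr => q _; rewrite /avg_shift [X in avg H X]delta_sum.
rewrite (linear_sumZ _ _ (avg_linear H)).
rewrite (linear_sumZ _ _ ((ten_bilin _ _).1 _)).
by apply: eq_bigr => p _; rewrite ffunE.
Qed.

Lemma tmap_coprodA (f : A) :
  tmap vsval vsval (coprodA f) = tmap (avg H) idfun (fun_coprod (vsval f)).
Proof.
rewrite /fun_coprod pair_bigA !(linear_sumZ _ _ (tmap_linear _ _)) /=.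
under eq_bigr do rewrite (tmapE _ _ (@vsval_linear _ _) (@vsval_linear _ _)) /=.
have idL : linear (@idfun A0) by [].
under [RHS]eq_bigr do rewrite (tmapE _ _ (avg_linear H) idL) /=.
rewrite (sum_ten_avg_shift _ (fun q => avg H (delta C q))).
rewrite (sum_ten_avg_shift _ (fun q => delta C q)).
by rewrite sum_ten_avg_delta //; apply: avg_shift_invariant.
Qed.

(** By linearity it suffices to expand [(u (x) u) (lambda_p (x) lambda_p) (u (x) u)], which is
    [F(lambda_p) (x) F(lambda_p)]. *)
Lemma tmap_coprodB (b : B) :
  tmap vsval vsval (coprodB b) =
    tmul (tmul (ten (unit_proj C H) (unit_proj C H)) (group_coprod (vsval b)))
         (ten (unit_proj C H) (unit_proj C H)).
Proof.
rewrite (linear_sumZ _ _ (tmap_linear _ _)).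
rewrite (linear_sumZ _ _ (tmul_linearr _)) (linear_sumZ _ _ (tmul_linearl _)).
apply: eq_bigr => p _; rewrite !tmulE tmapE //; exact: vsval_linear.
Qed.

End HeckePairing.

Theorem proposition4p10 (R : realType) (gT : finGroupType) (H : {group gT}) :
  [/\ forall (f : fun_alg R[i] gT) (b : group_alg R[i] gT),
        pairing0 (avg H f) b = pairing0 f (corner H b),
      star_pairing (@starA R[i] gT H) (@starB R[i] gT H)
        (@pairingAB R[i] gT H),
      forall D : 'Hom(algA R[i] H, tens (algA R[i] H) (algA R[i] H)),
        induced_coproductl (@pairingAB R[i] gT H) D ->
        forall f : algA R[i] H,
          tmap vsval vsval (D f) = tmap (avg H) idfun (fun_coprod (vsval f))
    & forall D : 'Hom(algB R[i] H, tens (algB R[i] H) (algB R[i] H)),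
        induced_coproductr (@pairingAB R[i] gT H) D ->
        forall b : algB R[i] H,
          tmap vsval vsval (D b) =
            tmul (tmul (ten (unit_proj R[i] H) (unit_proj R[i] H))
                       (group_coprod (vsval b)))
                 (ten (unit_proj R[i] H) (unit_proj R[i] H))].
Proof.
split.
- exact: pairing0_corner.
- exact: pairingAB_star_pairing.
- move=> D DE f.
  have := induced_coproductl_unique (@pairingAB_bilin _ gT H)
    (@pairingAB_nondegenerate _ gT H) DE (@coprodA_induced _ gT H).
  by move=> ->; rewrite lfunE tmap_coprodA.
- move=> D DE b.
  have := induced_coproductr_unique (@pairingAB_bilin _ gT H)
    (@pairingAB_nondegenerate _ gT H) DE (@coprodB_induced _ gT H).
  by move=> ->; rewrite lfunE tmap_coprodB.
Qed.
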